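(* Let $p$ be a prime, let $f=f_{\mathfrak A}\colon\mathbb Z_p\to\mathbb Z_p$ be the automaton function of an automaton $\mathfrak A$, and let $f$ be differentiable everywhere in a ball $B\subset\mathbb Z_p$ of non-zero radius. Then $f$ is of measure $1$, i.e. $\alpha(f)=1$, whenever the following two conditions hold simultaneously: (i) $f(B\cap\mathbb N_0)\subset\mathbb N_0$; (ii) $f$ is two times differentiable at some point $v\in B\cap\mathbb N_0$, and $f''(v)\neq0$.
   Context: Throughout, $\mathbb F_p=\{0,1,\ldots,p-1\}$ is used as an alphabet, $\mathbb N_0=\{0,1,2,\ldots\}$, and $\mathbb Z_p$ is the space of $p$-adic integers with the $p$-adic metric; $x=\sum_{i\ge 0}\chi_i p^i\in\mathbb Z_p$ (with $\chi_i\in\mathbb F_p$) is identified with the infinite word with letters $\chi_0,\chi_1,\chi_2,\ldots$. Balls of non-zero radius in $\mathbb Z_p$ are the sets $a+p^r\mathbb Z_p$ with $a\in\mathbb Z_p$, $r\in\mathbb N_0$. Differentiability is in the $p$-adic sense (limits of difference quotients in $\mathbb Q_p$ with respect to the $p$-adic absolute value); derivatives take values in $\mathbb Q_p$, and $f''$ is the derivative of $f'$. Automaton: a tuple $\mathfrak A=\mathfrak A(s_0)=\langle\mathbb F_p,\mathcal S,\mathbb F_p,S,O,s_0\rangle$ where $\mathcal S$ is a non-empty, possibly infinite, set of states, $S\colon\mathbb F_p\times\mathcal S\to\mathcal S$ is the state transition function, $O\colon\mathbb F_p\times\mathcal S\to\mathbb F_p$ is the output function, and $s_0\in\mathcal S$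 is the initial state. It is assumed that every state is reachable from $s_0$, i.e. every $s\in\mathcal S$ is the state reached from $s_0$ after feeding some finite input word. Automaton function: for an input $x=\sum_{i\ge0}\chi_ip^i$ put $s_{i+1}=S(\chi_i,s_i)$ and $\xi_i=O(\chi_i,s_i)$ for $i=0,1,2,\ldots$ (starting from the initial state $s_0$); then $f_{\mathfrak A}(x)=\sum_{i\ge0}\xi_ip^i$. For $x=\sum_{i\ge 0}\chi_ip^i\in\mathbb Z_p$ and $k\ge1$, $x\bmod p^k=\sum_{i=0}^{k-1}\chi_ip^i\in\{0,1,\ldots,p^k-1\}$. For $f\colon\mathbb Z_p\to\mathbb Z_p$ let $$E(f)=\bigcup_{k=1}^\infty\left\{\left(\frac{x\bmod p^k}{p^k},\frac{f(x)\bmod p^k}{p^k}\right)\colon x\in\mathbb Z_p\right\}\subset[0,1]\times[0,1],$$ let $\mathcal E(f)$ be the closure of $E(f)$ in the usual topology of $\mathbb R^2$, and let $\alpha(f)$ be the Lebesgue measure of $\mathcal E(f)$. *)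

(* Defs.v *)
From HB Require Import structures.
From mathcomp Require Import all_boot all_order all_algebra.
From mathcomp Require Import all_classical all_reals all_analysis.

Set Implicit Arguments.
Unset Strict Implicit.
Unset Printing Implicit Defensive.

Import Order.TTheory GRing.Theory Num.Theory.
Import numFieldNormedType.Exports.

Local Open Scope classical_set_scope.
Local Open Scope ring_scope.

(** Z_p is the inverse limit of the rings Z/p^n: [x] is given by its residues
    [residue x n] = x mod p^n in {0, ..., p^n - 1}.  The bound
    [residue x n < p ^ n] follows from the coherence condition because p > 0.
    The primality proof is an argument of the type so that the integral domain
    structure can be inferred. *)
Record padic_int (p : nat) (p_pr : prime p) := PadicInt {
  residue : nat -> nat;
  residue_coherent : forall n, residue n = (residue n.+1 %% p ^ n)%N }.

Section PadicInt.
Variables (p : nat) (p_pr : prime p).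
Local Notation Zp := (padic_int p_pr).
Implicit Types x y z : Zp.
Local Open Scope nat_scope.

HB.instance Definition _ := gen_eqMixin Zp.
HB.instance Definition _ := gen_choiceMixin Zp.

Lemma padic_ext x y : (forall n, residue x n = residue y n) -> x = y.
Proof.
case: x y => [s hs] [t ht] /= /funext st; subst t.
by congr PadicInt; exact: Prop_irrelevance.
Qed.

Lemma pX_gt0 n : 0 < p ^ n.
Proof. by rewrite expn_gt0 prime_gt0. Qed.

Lemma residueE x m n : m <= n -> residue x m = residue x n %% p ^ m.
Proof.
move=> /subnKC <-; elim: (n - m) => [|k IH].
  by rewrite addn0 [in RHS]residue_coherent modn_mod -residue_coherent.
by rewrite IH (residue_coherent x (m + k)) addnS modn_dvdm // dvdn_exp2l // leq_addr.
Qed.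

Lemma residue_mod x n : residue x n %% p ^ n = residue x n.
Proof. by rewrite -residueE. Qed.

Lemma residue_lt x n : residue x n < p ^ n.
Proof. by rewrite -residue_mod ltn_mod pX_gt0. Qed.

Fact padic_of_subproof (s : nat -> nat) :
  (forall n, s n = s n.+1 %[mod p ^ n]) ->
  forall n, s n %% p ^ n = (s n.+1 %% p ^ n.+1) %% p ^ n.
Proof. by move=> h n; rewrite modn_dvdm ?dvdn_exp2l. Qed.

Definition padic_of s hs : Zp :=
  PadicInt p_pr (@padic_of_subproof s hs).

Fact padic_add_subproof x y n :
  residue x n + residue y n = residue x n.+1 + residue y n.+1 %[mod p ^ n].
Proof. by rewrite !(residue_coherent _ n) modnDm. Qed.

Definition padic_add x y := padic_of (padic_add_subproof x y).

Fact padic_mul_subproof x y n :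
  residue x n * residue y n = residue x n.+1 * residue y n.+1 %[mod p ^ n].
Proof. by rewrite !(residue_coherent _ n) modnMm. Qed.

Definition padic_mul x y := padic_of (padic_mul_subproof x y).

Fact padic_opp_subproof x n :
  p ^ n - residue x n = p ^ n.+1 - residue x n.+1 %[mod p ^ n].
Proof.
apply/eqP; rewrite -(eqn_modDr (residue x n)) subnK; last exact/ltnW/residue_lt.
rewrite (residue_coherent x n) modnDmr subnK; last exact/ltnW/residue_lt.
by rewrite expnS modnMl modnn.
Qed.

Definition padic_opp x := padic_of (padic_opp_subproof x).

Definition padic_nat (k : nat) : Zp :=
  @padic_of (fun=> k) (fun=> erefl).

Fact padic_addA : associative padic_add.
Proof. by move=> x y z; apply: padic_ext => n /=; rewrite modnDmr modnDml addnA. Qed.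

Fact padic_addC : commutative padic_add.
Proof. by move=> x y; apply: padic_ext => n /=; rewrite addnC. Qed.

Fact padic_add0 : left_id (padic_nat 0) padic_add.
Proof. by move=> x; apply: padic_ext => n /=; rewrite mod0n add0n residue_mod. Qed.

Fact padic_addN : left_inverse (padic_nat 0) padic_opp padic_add.
Proof.
move=> x; apply: padic_ext => n /=.
by rewrite modnDml subnK ?modnn ?mod0n // ltnW ?residue_lt.
Qed.

HB.instance Definition _ :=
  GRing.isZmodule.Build Zp padic_addA padic_addC padic_add0 padic_addN.

Fact padic_mulA : associative padic_mul.
Proof. by move=> x y z; apply: padic_ext => n /=; rewrite modnMmr modnMml mulnA. Qed.

Fact padic_mulC : commutative padic_mul.
Proof. by move=> x y; apply: padic_ext => n /=; rewrite mulnC. Qed.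

Fact padic_mul1 : left_id (padic_nat 1) padic_mul.
Proof. by move=> x; apply: padic_ext => n /=; rewrite modnMml mul1n residue_mod. Qed.

Fact padic_mulD : left_distributive padic_mul padic_add.
Proof.
by move=> x y z; apply: padic_ext => n /=; rewrite modnMml mulnDl modnDm.
Qed.

Fact padic_1neq0 : padic_nat 1 != 0%R.
Proof.
apply/eqP => /(congr1 (fun x => residue x 1)) /=.
by rewrite expn1 mod0n modn_small // prime_gt1.
Qed.

HB.instance Definition _ := GRing.Zmodule_isComNzRing.Build Zp
  padic_mulA padic_mulC padic_mul1 padic_mulD padic_1neq0.

Lemma residue0 n : residue (0%R : Zp) n = 0.
Proof. exact: mod0n. Qed.

Lemma residueD x y n :
  residue (x + y)%R n = (residue x n + residue y n) %% p ^ n.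
Proof. by []. Qed.

Lemma residueM x y n :
  residue (x * y)%R n = (residue x n * residue y n) %% p ^ n.
Proof. by []. Qed.

Lemma residue_nat k n : residue (k%:R%R : Zp) n = k %% p ^ n.
Proof.
elim: k => [|k IH]; first by rewrite residue0 mod0n.
by rewrite -addn1 natrD residueD IH /= modnDm.
Qed.

Lemma residue_eq0 x : x != 0%R -> exists n, residue x n != 0.
Proof.
move=> x0; apply: contrapT => /forallNP h; move/eqP: x0; apply.
by apply: padic_ext => n; rewrite residue0; move/negP: (h n); rewrite negbK => /eqP.
Qed.

(** The valuation: the largest v with p^v dividing x, for x <> 0. *)
Definition padic_val x : nat :=
  if pselect (exists n, residue x n.+1 != 0) is left h then ex_minn h else 0.

Lemma residue_logn x n : x != 0%R -> padic_val x < n ->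
  0 < residue x n /\ logn p (residue x n) = padic_val x.
Proof.
move=> /residue_eq0[k xk]; rewrite /padic_val.
case: pselect => [h|nh]; last first.
  by case: nh; exists k; apply: contraNneq xk => xk; rewrite residue_coherent xk mod0n.
case: ex_minnP => v xv vmin vn.
have x_neq0 : 0 < residue x n.
  by rewrite lt0n; apply: contraNneq xv => xn; rewrite (residueE _ vn) xn mod0n.
split=> //; apply/eqP; rewrite eqn_leq; apply/andP; split.
  rewrite leqNgt; apply: contra xv => lt_v.
  by rewrite (residueE _ vn) -/(dvdn _ _) pfactor_dvdn.
rewrite -pfactor_dvdn // /dvdn -(residueE _ (ltnW vn)).
case: v xv vmin vn => [|v] xv vmin vn.
  by rewrite -residue_mod expn0 modn1.
by apply: contraT => /vmin; rewrite ltnn.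
Qed.

Lemma padic_valM x y : x != 0%R -> y != 0%R ->
  (x * y)%R != 0%R /\ padic_val (x * y)%R = padic_val x + padic_val y.
Proof.
move=> x0 y0; set a := padic_val x; set b := padic_val y.
have H n : a + b < n ->
    0 < residue (x * y)%R n /\ logn p (residue (x * y)%R n) = a + b.
  move=> abn.
  have [xn lx] := residue_logn x0 (leq_ltn_trans (leq_addr b a) abn).
  have [yn ly] := residue_logn y0 (leq_ltn_trans (leq_addl a b) abn).
  have xyn : 0 < residue x n * residue y n by rewrite muln_gt0 xn.
  have lxy : logn p (residue x n * residue y n) = a + b by rewrite lognM ?lx ?ly.
  have r0 : 0 < residue (x * y)%R n.
    rewrite lt0n residueM -/(dvdn _ _) pfactor_dvdn // lxy -ltnNge //.
  split=> //; apply/eqP; rewrite eqn_leq; apply/andP; split.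
    rewrite leqNgt -pfactor_dvdn // residueM.
    rewrite /dvdn modn_dvdm ?dvdn_exp2l // -/(dvdn _ _).
    by rewrite pfactor_dvdn // lxy ltnn.
  rewrite -pfactor_dvdn // residueM /dvdn modn_dvdm ?dvdn_exp2l 1?ltnW //.
  by rewrite -/(dvdn _ _) pfactor_dvdn // lxy.
have xy0 : (x * y)%R != 0%R.
  apply/eqP => e; have [] := H _ (ltnSn _).
  by rewrite e residue0 ltnn.
split=> //.
set n := (maxn (a + b) (padic_val (x * y)%R)).+1.
have ltn1 : a + b < n by rewrite ltnS leq_maxl.
have ltn2 : padic_val (x * y)%R < n by rewrite ltnS leq_maxr.
by have [_ <-] := H n ltn1; have [_ ->] := residue_logn xy0 ltn2.
Qed.

Local Open Scope ring_scope.

Definition padic_unit : pred Zp := fun x => `[< exists y, y * x = 1 >].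

Definition padic_inv x : Zp :=
  if pselect (exists y, y * x = 1) is left h then sval (cid h) else x.

Fact padic_mulVx : {in padic_unit, left_inverse 1 padic_inv *%R}.
Proof.
move=> x /asboolP h; rewrite /padic_inv.
by case: pselect => // h'; exact: (svalP (cid h')).
Qed.

Fact padic_unitPl x y : y * x = 1 -> padic_unit x.
Proof. by move=> yx; apply/asboolP; exists y. Qed.

Fact padic_inv_out : {in [predC padic_unit], padic_inv =1 id}.
Proof.
move=> x; rewrite inE /= => /asboolP h; rewrite /padic_inv.
by case: pselect.
Qed.

HB.instance Definition _ := GRing.ComNzRing_hasMulInverse.Build Zp
  padic_mulVx padic_unitPl padic_inv_out.

Fact padic_mulf_eq0 x y : x * y = 0 -> (x == 0) || (y == 0).
Proof.
move=> xy; case: eqVneq => //= x0; case: eqVneq => // y0.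
by have [] := padic_valM x0 y0; rewrite xy eqxx.
Qed.

HB.instance Definition _ :=
  GRing.ComUnitRing_isIntegral.Build Zp padic_mulf_eq0.

Fact digit_subproof x i : (residue x i.+1 %/ p ^ i < p)%N.
Proof. by rewrite ltn_divLR ?pX_gt0 // -expnS residue_lt. Qed.

Definition digit x (i : nat) : 'I_p := Ordinal (digit_subproof x i).

Fact of_digits_subproof (d : nat -> 'I_p) n :
  (\sum_(i < n) d i * p ^ i = \sum_(i < n.+1) d i * p ^ i %[mod p ^ n])%N.
Proof. by rewrite big_ord_recr /= addnC modnMDl. Qed.

Definition of_digits (d : nat -> 'I_p) : Zp :=
  padic_of (of_digits_subproof d).

Lemma residue_digits x n : residue x n = (\sum_(i < n) digit x i * p ^ i)%N.
Proof.
elim: n => [|n IH]; first by rewrite big_ord0 -residue_mod modn1.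
by rewrite big_ord_recr /= -IH (residue_coherent x n) addnC -divn_eq.
Qed.

Lemma of_digitsK x : of_digits (digit x) = x.
Proof. by apply: padic_ext => n /=; rewrite -residue_digits residue_mod. Qed.

Lemma digitK (d : nat -> 'I_p) : digit (of_digits d) = d.
Proof.
have small n : (\sum_(i < n) d i * p ^ i < p ^ n)%N.
  elim: n => [|n IH]; first by rewrite big_ord0.
  rewrite big_ord_recr /= expnS; apply: leq_trans (_ : (p ^ n + d n * p ^ n <= _)%N).
    by rewrite ltn_add2r.
  by rewrite -mulSn leq_mul2r ltn_ord orbT.
apply/funext => i; apply: val_inj => /=.
rewrite modn_small ?small // big_ord_recr /= [(_ + _)%N]addnC.
by rewrite divnMDl ?pX_gt0 // (divn_small (small i)) addn0.
Qed.

Definition naturals : set Zp := range (fun n : nat => n%:R).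

Definition padic_ball (a : Zp) (r : nat) : set Zp :=
  range (fun z => a + p%:R ^+ r * z).

Definition padic := {fraction Zp}.
Local Notation Qp := padic.

Definition padic_int_abs x : rat :=
  if x == 0 then 0 else p%:R ^- padic_val x.

Local Notation "x %:F" := (FracField.tofrac x) : ring_scope.

(** The value is taken in [rat] because |q| is 0 or a power of p.  It does not
    depend on the representative of q: see [padic_absE]. *)
Definition padic_abs (q : Qp) : rat :=
  padic_int_abs (repr q).1 / padic_int_abs (repr q).2.

Lemma padic_int_absM x y :
  padic_int_abs (x * y) = padic_int_abs x * padic_int_abs y.
Proof.
rewrite /padic_int_abs.
have [->|x0] := eqVneq x 0; first by rewrite !mul0r eqxx.
have [->|y0] := eqVneq y 0; first by rewrite !mulr0 eqxx.
have [/negPf -> ->] := padic_valM x0 y0.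
by rewrite exprD invfM.
Qed.

Lemma padic_int_abs_eq0 x : (padic_int_abs x == 0) = (x == 0).
Proof.
rewrite /padic_int_abs; case: ifP => [_|_]; first by rewrite eqxx.
apply/negbTE; rewrite invr_eq0 expf_neq0 //.
by rewrite pnatr_eq0 -lt0n prime_gt0.
Qed.

Lemma fracE (D : idomainType) (q : {fraction D}) :
  q = (repr q).1%:F / (repr q).2%:F.
Proof.
set r := repr q; have d0 : r.2%:F != 0.
  by rewrite tofrac_eq0; exact: denom_ratioP.
apply: (canRL (mulfK d0)); rewrite -[q]reprK -/r.
have {}d0 : r.2 != 0 by exact: denom_ratioP.
unlock FracField.tofrac; rewrite -[LHS]FracField.pi_mul.
apply/eqmodP; rewrite /= FracField.equivfE /FracField.mulf.
by rewrite !numden_Ratio ?mulf_neq0 ?oner_eq0 // !mulr1 mulrC.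
Qed.

Lemma padic_absE (n d : Zp) : d != 0 ->
  padic_abs (n%:F / d%:F) = padic_int_abs n / padic_int_abs d.
Proof.
move=> d0; rewrite /padic_abs; set q := (_ / _ : Qp).
have := fracE q; move: (denom_ratioP (repr q)).
move: (repr q).1 (repr q).2 => a b b0.
rewrite {}/q => /eqP; rewrite eqr_div ?tofrac_eq0 // -!tofracM tofrac_eq => /eqP e.
apply/eqP; rewrite eqr_div ?padic_int_abs_eq0 //.
by rewrite -!padic_int_absM e.
Qed.

Lemma padic_abs_int x : padic_abs x%:F = padic_int_abs x.
Proof.
have := padic_absE x (oner_neq0 Zp); rewrite tofrac1 divr1 => ->.
by rewrite -{1}(mulr1 x) padic_int_absM mulfK // padic_int_abs_eq0 oner_eq0.
Qed.

Fact pX_rat_gt0 n : 0 < p%:R ^- n :> rat.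
Proof. by rewrite invr_gt0 exprn_gt0 // ltr0n prime_gt0. Qed.

Lemma padic_int_abs_ge0 x : 0 <= padic_int_abs x.
Proof. by rewrite /padic_int_abs; case: ifP => // _; exact/ltW/pX_rat_gt0. Qed.

Lemma padic_int_abs_le x n :
  (padic_int_abs x <= p%:R ^- n) = (residue x n == 0%N).
Proof.
rewrite /padic_int_abs; case: eqVneq => [->|x0].
  by rewrite residue0 eqxx; apply/ltW/pX_rat_gt0.
have p1 : 1 < p%:R :> rat by rewrite ltr1n prime_gt1.
rewrite lef_pV2 ?posrE ?exprn_gt0 ?(lt_trans _ p1) // ler_eXn2l //.
set v := padic_val x.
have [xv lv] := residue_logn x0 (ltnSn v).
case: (leqP n v) => nv.
  rewrite (@residueE x n v.+1) ?(leqW nv) // -/(dvdn _ _).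
  by rewrite pfactor_dvdn // lv nv.
by have [] := residue_logn x0 nv; rewrite lt0n => /negPf ->.
Qed.

Lemma padic_int_absD x y :
  padic_int_abs (x + y) <= Num.max (padic_int_abs x) (padic_int_abs y).
Proof.
wlog xy : x y / padic_int_abs x <= padic_int_abs y.
  move=> h; case/orP: (le_total (padic_int_abs x) (padic_int_abs y)); first exact: h.
  by rewrite addrC maxC; exact: h.
rewrite (max_idPr xy); move: xy.
case: (eqVneq y 0) => [->|y0]; first by rewrite addr0.
have ey : padic_int_abs y = p%:R ^- padic_val y.
  by rewrite /padic_int_abs (negPf y0).
rewrite {1 2}ey !padic_int_abs_le residueD => /eqP ->.
by rewrite add0n residue_mod -padic_int_abs_le ey.
Qed.

Lemma padic_absD (q r : Qp) :
  padic_abs (q + r) <= Num.max (padic_abs q) (padic_abs r).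
Proof.
rewrite (fracE q) (fracE r); move: (denom_ratioP (repr q)) (denom_ratioP (repr r)).
move: (repr q).1 (repr q).2 (repr r).1 (repr r).2 => a b c d b0 d0.
rewrite addf_div ?tofrac_eq0 // -!tofracM -tofracD !padic_absE ?mulf_neq0 //.
have gt0 z : z != 0 -> 0 < padic_int_abs z.
  by move=> z0; rewrite lt_neqAle padic_int_abs_ge0 eq_sym padic_int_abs_eq0 z0.
rewrite ler_pdivrMr ?gt0 ?mulf_neq0 // maxr_pMl; last first.
  exact: padic_int_abs_ge0.
apply: le_trans (padic_int_absD _ _) _; rewrite !padic_int_absM.
rewrite (mulrA (_ / padic_int_abs b)) mulfVK ?padic_int_abs_eq0 //.
by rewrite (mulrC (padic_int_abs b)) (mulrA (_ / padic_int_abs d)) mulfVK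
  ?padic_int_abs_eq0.
Qed.

Lemma padic_abs_eq0 (q : Qp) : (padic_abs q == 0) = (q == 0).
Proof.
rewrite {2}(fracE q) /padic_abs !mulf_eq0 !invr_eq0 !tofrac_eq0.
by rewrite !padic_int_abs_eq0.
Qed.

Lemma padic_absN (q : Qp) : padic_abs (- q) = padic_abs q.
Proof.
have N1 : padic_int_abs (-1) = 1.
  apply/eqP; rewrite -(@eqrXn2 _ 2) ?padic_int_abs_ge0 //.
  rewrite expr1n expr2 -padic_int_absM mulrNN mulr1.
  have : padic_int_abs 1 != 0 by rewrite padic_int_abs_eq0 oner_eq0.
  move=> /mulfI h; apply/eqP/h.
  by rewrite -padic_int_absM !mulr1.
rewrite (fracE q); set a := (repr q).1; set b := (repr q).2.
have b0 : b != 0 by exact: denom_ratioP.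
by rewrite -mulNr -tofracN !padic_absE // -mulN1r padic_int_absM N1 mul1r.
Qed.

Definition padic_lim (g : Zp -> Qp) (a : Zp) (l : Qp) : Prop :=
  forall e : rat, 0 < e -> exists2 d : rat, 0 < d &
    forall x, 0 < padic_int_abs (x - a) < d -> padic_abs (g x - l) < e.

Definition is_padic_derive (f : Zp -> Qp) (a : Zp) (l : Qp) : Prop :=
  padic_lim (fun x => (f x - f a) / (x%:F - a%:F)) a l.

Lemma padic_lim_unique (g : Zp -> Qp) a l m :
  padic_lim g a l -> padic_lim g a m -> l = m.
Proof.
move=> gl gm; apply/eqP; rewrite -subr_eq0 -padic_abs_eq0; apply: contraT => lm.
have e0 : 0 < padic_abs (l - m).
  by rewrite lt_neqAle eq_sym lm divr_ge0 ?padic_int_abs_ge0.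
have [d d0 dl] := gl _ e0; have [d' d'0 dm] := gm _ e0.
have mn0 : 0 < Num.min d d' by rewrite lt_min d0.
have [n nd] : exists n, p%:R ^- n < Num.min d d'.
  exists (Num.bound (Num.min d d')^-1).
  rewrite invf_plt ?posrE ?exprn_gt0 ?ltr0n ?prime_gt0 //.
  have := archi_boundP (ltW (_ : 0 < (Num.min d d')^-1)).
  rewrite invr_gt0 => /(_ mn0) h; apply: (lt_le_trans h).
  by rewrite -natrX ler_nat ltnW // ltn_expl // prime_gt1.
have xn : 0 < padic_int_abs (a + (p ^ n)%:R - a) < Num.min d d'.
  rewrite addrC addKr; apply/andP; split.
    rewrite lt_neqAle padic_int_abs_ge0 andbT eq_sym padic_int_abs_eq0.
    apply/eqP => /(congr1 (fun x => residue x n.+1)) /eqP.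
    rewrite residue_nat residue0 -/(dvdn _ _) pfactor_dvdn ?pX_gt0 //.
    by rewrite pfactorK // ltnn.
  by apply: le_lt_trans nd; rewrite padic_int_abs_le residue_nat modnn.
case/andP: xn => x0; rewrite lt_min => /andP[xd xd'].
have := padic_absD (l - g (a + (p ^ n)%:R)) (g (a + (p ^ n)%:R) - m).
rewrite addrA subrK leNgt gt_max -[X in padic_abs X < _]opprB padic_absN.
by rewrite dl ?dm ?x0.
Qed.

Lemma is_padic_derive_unique (f : Zp -> Qp) a l m :
  is_padic_derive f a l -> is_padic_derive f a m -> l = m.
Proof. exact: padic_lim_unique. Qed.

Definition padic_derivable (f : Zp -> Qp) (a : Zp) : Prop :=
  exists l, is_padic_derive f a l.

(** The value is 0 where f is not differentiable; elsewhere it is determined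
    by [is_padic_derive_unique]. *)
Definition padic_derive (f : Zp -> Qp) (a : Zp) : Qp :=
  xget 0 [set l | is_padic_derive f a l].

Definition padic_derivable2 (f : Zp -> Qp) (a : Zp) : Prop :=
  (exists r, forall x, padic_ball a r x -> padic_derivable f x) /\
  padic_derivable (padic_derive f) a.

End PadicInt.

Arguments naturals {p p_pr}.

Notation "x %:F" := (FracField.tofrac x) : ring_scope.

(** [reachable]: every state is reached from the initial one by feeding some
    finite input word, the letters being read from left to right. *)
Record automaton (p : nat) := Automaton {
  state : Type;
  transition : 'I_p -> state -> state;
  output : 'I_p -> state -> 'I_p;
  initial : state;
  reachable : forall s, exists w : seq 'I_p,
    s = foldl (fun t c => transition c t) initial w }.

Section AutomatonFunction.
Variables (p : nat) (p_pr : prime p) (A : automaton p).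
Local Notation Zp := (padic_int p_pr).

(** The state reached after feeding the digits of x of index < i. *)
Fixpoint run (x : Zp) (i : nat) : state A :=
  if i is j.+1 then transition (digit x j) (run x j) else initial A.

Definition automaton_fun (x : Zp) : Zp :=
  of_digits p_pr (fun i => output (digit x i) (run x i)).

End AutomatonFunction.

Section Plot.
Variables (R : realType) (p : nat) (p_pr : prime p).
Local Notation Zp := (padic_int p_pr).

Definition plot (f : Zp -> Zp) : set (R * R) :=
  \bigcup_(k in [set k | (1 <= k)%N])
    range (fun x : Zp => ((residue x k)%:R / p%:R ^+ k,
                          (residue (f x) k)%:R / p%:R ^+ k)).

(** The closure is a Borel set, so that the product of two Lebesgue measures
    gives its two-dimensional Lebesgue measure. *)
Definition plot_measure (f : Zp -> Zp) : \bar R :=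
  (lebesgue_measure \x lebesgue_measure)%E (closure (plot f)).

End Plot.

(* Main.v *)
Require Import Defs.
From mathcomp Require Import all_boot all_order all_algebra.
From mathcomp Require Import all_classical all_reals all_analysis.
From mathcomp Require Import zify ring lra.

Local Open Scope classical_set_scope.
Local Open Scope ring_scope.

(** Dividing a residue mod p^k by p^k places its last digits first, so a pair
    of residues lies in a given cell of the p^-m grid of the unit square when
    the m digits below position k of x and of f x are two prescribed words.
    Hence the closure of the plot is the whole square as soon as every pair of
    words of length m occurs at a common position of some x and f x
    ([plot_measure_eq1]), and the proof constructs such an x.

    Let x be a natural number in B.  As x and f x are natural, all their digits
    of large index vanish, and by differentiability
      f (x + p^K z) = f x + p^K f'(x) z   mod p^(K + M)
    for K large.  So, above position K, the digits of the input are those of z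
    and the digits of the output are those of f'(x) z: only the linear map
    z |-> f'(x) z is seen there.

    A fixed slope does not give all pairs of words, but slopes can be moved.
    Since f''(v) <> 0, for n large the numbers f'(v + p^n t), t natural, take the values
    f'(v) + p^N w mod p^(N + m) for every w, where N - n is the valuation of
    f''(v) ([derivative_spread]).  Take z = 1 + p^N i, i being the number that
    spells the input word.  Then
      f'(x) z = f'(v) + p^N (w + f'(v) i)   mod p^(N + m)   (N >= m),
    whose digits at positions N, ..., N + m - 1 are shifted by w, so w can be
    chosen to make them spell any output word, whatever the digits of f'(v) and
    the word i ([digit_windows_realized]).

    An automaton function is 1-Lipschitz, whence f' is integral and may be
    replaced by an element of Z_p at any finite precision
    ([derivative_near_padic_int]). *)

(** * Congruences and differentiation in Z_p *)

Section PadicNumbers.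
Set Implicit Arguments.
Unset Strict Implicit.
Import Order.TTheory GRing.Theory Num.Theory.

Variables (p : nat) (p_pr : prime p).
Local Notation Zp := (padic_int p_pr).
Local Notation Qp := (padic p_pr).
Implicit Types (x y z : Zp) (q : Qp) (n m : nat).

Lemma padic_absM q q' : padic_abs (q * q') = padic_abs q * padic_abs q'.
Proof.
rewrite (fracE q) (fracE q').
move: (denom_ratioP (repr q)) (denom_ratioP (repr q')).
move: (repr q).1 (repr q).2 (repr q').1 (repr q').2 => a b c d b0 d0.
rewrite mulf_div -!tofracM !padic_absE ?mulf_neq0 // !padic_int_absM.
by rewrite mulf_div.
Qed.

Lemma padic_abs_ge0 q : 0 <= padic_abs q.
Proof. by rewrite divr_ge0 ?padic_int_abs_ge0. Qed.

Lemma padic_abs_leD (e : rat) q q' :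
  padic_abs q <= e -> padic_abs q' <= e -> padic_abs (q + q') <= e.
Proof.
by move=> qe qe'; apply: le_trans (padic_absD _ _) _; rewrite ge_max qe.
Qed.

Lemma padic_abs_tofrac_le x n :
  (padic_abs (x%:F) <= p%:R ^- n) = (residue x n == 0%N).
Proof. by rewrite padic_abs_int padic_int_abs_le. Qed.

Lemma padic_int_abs_pX n : padic_int_abs (p%:R ^+ n : Zp) = p%:R ^- n.
Proof.
have pn0 : (p%:R ^+ n : Zp) != 0.
  rewrite -natrX; apply/eqP => /(congr1 (fun x => residue x n.+1)) /eqP.
  by rewrite residue_nat residue0 -/(dvdn _ _) pfactor_dvdn ?pX_gt0 // pfactorK
     // ltnn.
rewrite /padic_int_abs (negPf pn0); congr (_ ^- _).
set v := padic_val _; set k := (maxn v n).+1.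
have [|_] := @residue_logn _ _ _ k pn0; first by rewrite ltnS leq_maxl.
rewrite -/v => <-.
rewrite -natrX residue_nat modn_small ?pfactorK //.
by rewrite ltn_exp2l ?prime_gt1 // ltnS leq_maxr.
Qed.

Lemma padic_abs_pX n : padic_abs ((p%:R ^+ n : Zp)%:F) = p%:R ^- n.
Proof. by rewrite padic_abs_int padic_int_abs_pX. Qed.

(** The quotient is the digit sequence of x shifted by n places. *)
Lemma residue0_dvd x n : residue x n = 0%N -> exists z, x = p%:R ^+ n * z.
Proof.
move=> xn0.
have coh i : (residue x (i + n) %/ p ^ n =
              residue x (i.+1 + n) %/ p ^ n %[mod p ^ i])%N.
  rewrite (@residueE _ _ x (i + n) (i.+1 + n)) ?leq_add2r ?leqnSn //.
  by rewrite expnD -modn_divl modn_mod.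
exists (padic_of p_pr coh); apply: padic_ext => i.
rewrite residueM -natrX residue_nat /= modnMm mulnC divnK.
  by rewrite -residueE // leq_addr.
by rewrite /dvdn -residueE ?leq_addl // xn0.
Qed.

Lemma residue_congr x y n :
  residue x n = residue y n -> exists z, x = y + p%:R ^+ n * z.
Proof.
move=> e; have [|z ez] := @residue0_dvd (x - y) n; last first.
  by exists z; rewrite -ez addrC subrK.
apply/eqP; rewrite -(residue_mod (x - y)) -(mod0n (p ^ n)).
rewrite -(eqn_modDr (residue y n)) add0n residue_mod -residueD subrK.
by rewrite e.
Qed.

Lemma residueD_pX x z n : residue (x + p%:R ^+ n * z) n = residue x n.
Proof.
by rewrite residueD residueM -natrX residue_nat modnn mul0n mod0n addn0
  residue_mod.
Qed.

(** First-order expansion along x + p^n Z_p, uniform in the direction z: the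
    definition of the derivative bounds the difference quotient by distance
    alone, and multiplying by the increment gains the factor p^-n. *)
Lemma padic_derive_expansion (g : Zp -> Qp) x l (s : nat) : is_padic_derive g x l ->
  exists n0, forall n z, (n0 <= n)%N ->
    padic_abs (g (x + p%:R ^+ n * z) - g x - l * (p%:R ^+ n * z)%:F)
      <= p%:R ^- (n + s).
Proof.
move=> gl; have [d d0 dl] := gl _ (pX_rat_gt0 p_pr s).
have p1 : 1 < p%:R :> rat by rewrite ltr1n prime_gt1.
(* p^-n < d as soon as n is at least 1/d, because n < p^n. *)
exists (Num.bound d^-1) => n z n0n; set h := _ * z.
have [->|h0] := eqVneq h 0.
  by rewrite addr0 subrr tofrac0 mulr0 subrr (eqP (_ : padic_abs 0 == 0))
     ?padic_abs_eq0 // ltW ?pX_rat_gt0.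
have hn : padic_int_abs h <= p%:R ^- n.
  by rewrite padic_int_abs_le /h residueM -natrX residue_nat modnn mul0n mod0n.
have hF : h%:F != 0 by rewrite tofrac_eq0.
have := dl (x + h); rewrite addrAC subrr add0r => /(_ _)/ltW le_s.
have -> : g (x + h) - g x - l * h%:F
          = ((g (x + h) - g x) / ((x + h)%:F - x%:F) - l) * h%:F.
  by rewrite [X in _ / X - _](_ : _ = h%:F) ?mulrBl ?divfK // tofracD addrAC
    subrr add0r.
rewrite padic_absM addnC exprD invfM ler_pM ?padic_abs_ge0 //.
  apply: le_s; rewrite lt_neqAle padic_int_abs_ge0 eq_sym padic_int_abs_eq0 h0 /=.
  apply: le_lt_trans hn _.
  rewrite invf_plt ?posrE ?exprn_gt0 ?(lt_trans _ p1) //.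
  have := archi_boundP (ltW (_ : 0 < d^-1)); rewrite invr_gt0 => /(_ d0) db.
  apply: lt_le_trans db _; rewrite -natrX ler_nat.
  by apply: leq_trans n0n _; rewrite ltnW // ltn_expl // prime_gt1.
by rewrite padic_abs_int.
Qed.

Lemma coprime_residue x n : residue x 1 != 0%N -> coprime (p ^ n) (residue x n).
Proof.
case: n => [|n] x1; first by rewrite expn0 coprime1n.
rewrite coprime_pexpl // prime_coprime //.
by rewrite (@residueE _ _ _ 1 n.+1) // expn1 in x1.
Qed.

Lemma padic_unit_part x : x != 0 ->
  exists2 u, x = p%:R ^+ padic_val x * u & residue u 1 != 0%N.
Proof.
move=> x0; set v := padic_val x.
have [xv lv] := residue_logn x0 (ltnSn v).
have [|u xu] := @residue0_dvd x v.
  apply/eqP; rewrite (@residueE _ _ _ v v.+1) // -/(dvdn _ _).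
  by rewrite pfactor_dvdn // lv.
exists u => //; apply/eqP => u0.
have [z uz] := residue0_dvd u0; move: xv.
by rewrite xu uz mulrA -exprD addn1 residueM -natrX residue_nat modnn mul0n mod0n.
Qed.

(** A p-adic unit is invertible mod p^m, by Bezout on its residue. *)
Lemma solve_linear_mod x y m : residue x 1 != 0%N ->
  exists t : nat, residue (x * t%:R - y) m = 0%N.
Proof.
move=> x1; have pm := pX_gt0 p_pr m.
have [b _ /eqP] := Bezoutl (residue x m) pm.
rewrite (eqP (coprime_residue m x1)) => e.
set k := residue (- y) m.
exists (k * b)%N; rewrite residueD residueM residue_nat modnMmr -/k modnDml.
rewrite mulnCA -mulnSr -addn1 addnC (mulnC (residue x m)).
by apply/eqP; apply: dvdn_mull; apply/eqP.
Qed.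

(** With l = p^e u and u a unit, g (v + p^n t) - g v is p^(n + e) u t up to a
    much smaller term, and u t is arbitrary mod p^m.  The exponent e may be
    negative: l is handled as a quotient of two elements of Z_p, and the lemma
    exposes only N = n + e. *)
Lemma derivative_spread (g : Zp -> Qp) v l (m r : nat) :
  is_padic_derive g v l -> l != 0 ->
  exists2 N, (m < N)%N & forall w : nat, exists n t : nat, (r <= n)%N /\
    padic_abs (g (v + p%:R ^+ n * t%:R) - g v - (p%:R ^+ N * w%:R)%:F)
      <= p%:R ^- (N + m).
Proof.
move=> gl l0; have p1 : 1 < p%:R :> rat by rewrite ltr1n prime_gt1.
have p0 k : (p%:R ^+ k : rat) != 0 by rewrite expf_neq0 // gt_eqF // (lt_trans _ p1).
set a := (repr l).1; set b := (repr l).2; have b0 : b != 0 := denom_ratioP _.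
have la : l = a%:F / b%:F := fracE l.
have a0 : a != 0 by apply: contra_neq l0; rewrite la => ->; rewrite tofrac0 mul0r.
have [a' aE a'1] := padic_unit_part a0; have [b' bE b'1] := padic_unit_part b0.
have abs_b : padic_abs (b%:F) = p%:R ^- padic_val b.
  by rewrite padic_abs_int /padic_int_abs (negPf b0).
move: (padic_val a) (padic_val b) aE bE abs_b => i j aE bE abs_b.
have [n0 lim] := padic_derive_expansion (m + i) gl.
(* The summand (m + j).+1 makes N = n - j + i exceed m. *)
set n := (maxn n0 r + (m + j).+1)%N.
have jn : (j <= n)%N by rewrite /n -addSn addnA leq_addl.
have n0n : (n0 <= n)%N by rewrite (leq_trans (leq_maxl n0 r)) ?leq_addr.
exists (n - j + i)%N.
  rewrite /n -addSn addnA addnK; apply: leq_trans (leq_addr _ _).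
  by rewrite leq_addl.
move=> w; set N := (n - j + i)%N.
have [t ht] := solve_linear_mod (b' * w%:R) m a'1.
exists n, t; split; first by rewrite (leq_trans (leq_maxr n0 r)) ?leq_addr.
set h := p%:R ^+ n * t%:R.
have -> : g (v + h) - g v - (p%:R ^+ N * w%:R)%:F =
  (g (v + h) - g v - l * h%:F) + (l * h%:F - (p%:R ^+ N * w%:R)%:F).
  by rewrite addrA subrK.
apply: padic_abs_leD.
  apply: le_trans (lim _ _ n0n) _.
  rewrite lef_pV2 ?posrE ?exprn_gt0 ?(lt_trans _ p1) // ler_eXn2l //.
  by rewrite /N -addnA [(i + m)%N]addnC leq_add2r leq_subr.
have bF : b%:F != 0 by rewrite tofrac_eq0.
have -> : l * h%:F - (p%:R ^+ N * w%:R)%:F =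
  (p%:R ^+ (n + i) : Zp)%:F * (a' * t%:R - b' * w%:R)%:F / b%:F.
  apply: (mulIf bF); rewrite divfK // mulrBl la mulrAC divfK // -!tofracM -tofracB.
  have nij : (n + i = N + j)%N by rewrite /N; clearbody n; lia.
  congr (_ %:F); rewrite mulrBr; congr (_ - _).
    by rewrite aE /h exprD; ring.
  by rewrite nij exprD bE; ring.
rewrite 2!padic_absM padic_abs_pX.
have -> : padic_abs (b%:F)^-1 = p%:R ^+ j.
  apply: (@mulfI _ (padic_abs (b%:F))); first by rewrite padic_abs_eq0.
  have := padic_int_abs_pX 0; rewrite !expr0 invr1 => abs1.
  by rewrite -padic_absM divff // -tofrac1 padic_abs_int abs1 abs_b mulVf.
have := padic_abs_tofrac_le (a' * t%:R - b' * w%:R) m; rewrite ht eqxx.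
move: (padic_abs _) => e em.
apply: le_trans (_ : p%:R ^- (n + i) * p%:R ^- m * p%:R ^+ j <= _).
  rewrite ler_wpM2r ?exprn_ge0 ?(ltW (lt_trans _ p1)) //.
  by rewrite ler_wpM2l // ltW // pX_rat_gt0.
rewrite -invfM -exprD ler_pdivrMl ?exprn_gt0 ?(lt_trans _ p1) //.
have -> : (n + i + m = N + m + j)%N by rewrite /N; clearbody n; lia.
by rewrite exprD mulrAC divff ?mul1r.
Qed.

End PadicNumbers.

(** * Digits of automaton functions *)

Section AutomatonFunctions.
Set Implicit Arguments.
Unset Strict Implicit.
Import Order.TTheory GRing.Theory Num.Theory.

Variables (p : nat) (p_pr : prime p) (A : automaton p).
Local Notation Zp := (padic_int p_pr).
Local Notation f := (automaton_fun (p_pr := p_pr) A).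
Local Notation fQ := (fun x => (f x)%:F).
Implicit Types (x y z : Zp) (n m : nat).

(** The n-th output letter depends on the input letters of index at most n. *)
Lemma automaton_fun_lipschitz x y n :
  residue x n = residue y n -> residue (f x) n = residue (f y) n.
Proof.
move=> xy; have dig i : (i < n)%N -> digit x i = digit y i.
  by move=> lt_in; apply: val_inj => /=; rewrite !(residueE _ lt_in) xy.
have runE i : (i <= n)%N -> run A x i = run A y i.
  by elim: i => //= i IH lt_in; rewrite dig // IH // ltnW.
rewrite !residue_digits; apply: eq_bigr => i _; rewrite /automaton_fun !digitK.
by rewrite dig // runE // ltnW.
Qed.

(** The difference quotients at increments p^n are in Z_p by the Lipschitz
    property, and one of them is p^-m close to the derivative. *)
Lemma derivative_near_padic_int x (l : padic p_pr) m : is_padic_derive fQ x l ->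
  exists c : Zp, padic_abs (l - c%:F) <= p%:R ^- m.
Proof.
move=> /(padic_derive_expansion m)[n lim]; have := lim n 1 (leqnn n).
have [|c ->] := @residue_congr _ _ (f (x + p%:R ^+ n * 1)) (f x) n.
  by apply: automaton_fun_lipschitz; rewrite residueD_pX.
rewrite mulr1 tofracD (addrC (f x)%:F) addrK tofracM (mulrC _ (c%:F)) -mulrBl.
rewrite padic_absM padic_abs_pX exprD invfM [X in _ <= X]mulrC.
rewrite ler_pM2r ?pX_rat_gt0 // => cl; exists c.
by rewrite -padic_absN opprB.
Qed.

Lemma automaton_fun_expansion x l c m : is_padic_derive fQ x l ->
  padic_abs (l - c%:F) <= p%:R ^- m ->
  exists n0, forall n z, (n0 <= n)%N ->
    residue (f (x + p%:R ^+ n * z)) (n + m)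
    = residue (f x + p%:R ^+ n * (c * z)) (n + m).
Proof.
move=> /(padic_derive_expansion m)[n0 lim] lc; exists n0 => n z n0n.
set y := f x + _; set u := f _.
suff [z' ->] : exists z', u = y + p%:R ^+ (n + m) * z' by rewrite residueD_pX.
have [|z' e] := @residue0_dvd _ _ (u - y) (n + m); last first.
  by exists z'; rewrite -e addrC subrK.
apply/eqP; rewrite -padic_abs_tofrac_le.
have -> : (u - y)%:F = (u%:F - (f x)%:F - l * (p%:R ^+ n * z)%:F)
                       + (l - c%:F) * (p%:R ^+ n * z)%:F.
  rewrite mulrBl addrA subrK -tofracM -!tofracB; congr (_%:F).
  by rewrite /y; ring.
apply: padic_abs_leD; first exact: lim.
rewrite padic_absM addnC exprD invfM ler_pM ?padic_abs_ge0 //.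
rewrite padic_abs_tofrac_le residueM -natrX residue_nat modnn mul0n mod0n //.
Qed.

Lemma window_of_sum k m i j : (i < p ^ k)%N -> (j < p ^ m)%N ->
  ((i + p ^ k * j) %% p ^ (k + m) %/ p ^ k = j)%N.
Proof.
move=> ik jm; have pk := pX_gt0 p_pr k.
rewrite expnD [(p ^ k * p ^ m)%N]mulnC -modn_divl [(p ^ k * j)%N]mulnC addnC divnMDl //.
by rewrite divn_small // addn0 modn_small.
Qed.

(** The increment 1 + p^N i shows the word i at position N of the input.  Its
    summand 1 makes the slope f'(x) itself appear in the output, and the digits
    of f'(x) from position N on are tuned by w without changing the input word. *)
Lemma digit_windows_realized a r :
  let B := padic_ball a r in
  (forall x, B x -> padic_derivable fQ x) ->
  f @` (B `&` naturals) `<=` naturals ->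
  (exists v, [/\ (B `&` naturals) v, padic_derivable2 fQ v &
                 padic_derive (padic_derive fQ) v != 0]) ->
  forall m i j, (i < p ^ m)%N -> (j < p ^ m)%N ->
  exists k x, (residue x (k + m) %/ p ^ k = i)%N /\
              (residue (f x) (k + m) %/ p ^ k = j)%N.
Proof.
move=> B derf natf [v [[[z0 _ vE] [V _ VE]] [_ der2] fv_neq0]] m i j im jm.
set g := padic_derive fQ in der2 fv_neq0.
have derE (h : Zp -> padic p_pr) x :
    padic_derivable h x -> is_padic_derive h x (padic_derive h x).
  by move=> [l hl]; apply: (@xgetPex _ 0 [set l | is_padic_derive h x l]); exists l.
have [N mN spread] := derivative_spread m r (derE _ _ der2) fv_neq0.
have Bv : B v by exists z0.
have [c0 c0E] := derivative_near_padic_int (N + m) (derE _ _ (derf _ Bv)).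
set C := residue c0 (N + m); set D := (C %/ p ^ N)%N; set c1 := (C %% p ^ N)%N.
(* Mod p^m this is j - (D + C i): it cancels the digits D of f'(v) at positions
   N, ..., N + m - 1 and the contribution C i of the input word. *)
pose w := (j + (p ^ m - 1) * (D + C * i))%N.
have [n [t [rn xE]]] := spread w.
set x := v + _ in xE.
have Bx : B x.
  exists (z0 + p%:R ^+ (n - r) * t%:R) => //.
  by rewrite mulrDr addrA vE mulrA -exprD subnKC.
have xX : x = (V + p ^ n * t)%:R by rewrite /x -VE natrD natrM natrX.
move: (V + _)%N xX => X xX.
have [F _ fxF] : naturals (f x) by apply: natf; exists x => //; split=> //; exists X.
set c := c0 + p%:R ^+ N * w%:R.
have cE : padic_abs (g x - c%:F) <= p%:R ^- (N + m).
  have -> : g x - c%:F = (g x - g v - (p%:R ^+ N * w%:R)%:F) + (g v - c0%:F).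
    by rewrite /c tofracD; ring.
  exact: padic_abs_leD.
have [n0 expand] := automaton_fun_expansion (derE _ _ (derf _ Bx)) cE.
(* K exceeds the lengths of the expansions of x and f x, since X < p^X. *)
set K := (n0 + X + F)%N.
have KN : (p ^ K < p ^ (K + N))%N.
  by rewrite ltn_exp2l ?prime_gt1 // -[ltnLHS]addn0 ltn_add2l (leq_ltn_trans _ mN).
have small b : (b <= K)%N -> (b < p ^ K)%N.
  by move=> bK; apply: leq_ltn_trans bK (ltn_expl _ (prime_gt1 p_pr)).
have big b d : (b < p ^ K)%N -> (d < p ^ N)%N -> (b + p ^ K * d < p ^ (K + N))%N.
  move=> bK dN; rewrite expnD; apply: leq_trans (_ : p ^ K * d.+1 <= _)%N.
    by rewrite mulnS ltn_add2r.
  by rewrite leq_mul2l dN orbT.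
exists (K + N)%N, (x + p%:R ^+ K * (1 + p ^ N * i)%:R); split.
  have -> : x + p%:R ^+ K * (1 + p ^ N * i)%:R =
            (X + p ^ K * 1 + p ^ (K + N) * i)%:R.
    by rewrite xX expnD !(natrD, natrM, natrX); ring.
  rewrite residue_nat window_of_sum // big //.
    by apply: small; rewrite /K; lia.
  by rewrite -{1}(expn0 p) ltn_exp2l ?prime_gt1 // (leq_ltn_trans _ mN).
rewrite -addnA expand; last by rewrite /K; lia.
rewrite -fxF; have [|e c0C] := @residue_congr _ _ c0 C%:R (N + m).
  by rewrite residue_nat residue_mod.
have -> : F%:R + p%:R ^+ K * (c * (1 + p ^ N * i)%:R) =
  (F + p ^ K * ((C + p ^ N * w) * (1 + p ^ N * i)))%:R +
  p%:R ^+ (K + (N + m)) * (e * (1 + p ^ N * i)%:R) :> Zp.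
  by rewrite /c c0C !(natrD, natrM, natrX, exprD); ring.
rewrite residueD_pX residue_nat.
have CE : C = (D * p ^ N + c1)%N by exact: divn_eq.
have NE : (p ^ N = p ^ m * p ^ (N - m))%N by rewrite -expnD subnKC // ltnW.
have wE : (D + w + C * i = j + p ^ m * (D + C * i))%N.
  rewrite /w mulnBl mul1n; have := pX_gt0 p_pr m.
  set q := (D + C * i)%N => pm.
  have -> : (D + (j + (p ^ m * q - q)) + C * i = j + (p ^ m * q - q + q))%N.
    by rewrite [in RHS]/q; ring.
  by rewrite subnK // leq_pmull.
have -> : (F + p ^ K * ((C + p ^ N * w) * (1 + p ^ N * i)) =
  (D + C * i + p ^ (N - m) * w * i) * p ^ (K + (N + m)) +
   (F + p ^ K * c1 + p ^ (K + N) * j))%N.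
  have -> : (F + p ^ K * ((C + p ^ N * w) * (1 + p ^ N * i)) =
     F + p ^ K * (C + p ^ N * (w + C * i) + p ^ N * p ^ N * (w * i)))%N by ring.
  rewrite {1}CE.
  have -> : (D * p ^ N + c1 + p ^ N * (w + C * i) = c1 + p ^ N * (D + w + C * i))%N by ring.
  rewrite wE {2}NE !expnD; ring.
rewrite modnMDl addnA window_of_sum // big ?ltn_mod ?pX_gt0 //.
by apply: small; rewrite /K; lia.
Qed.

End AutomatonFunctions.

(** * Measure of the plot *)

Section PlotMeasure.
Set Implicit Arguments.
Unset Strict Implicit.
Import Order.TTheory GRing.Theory Num.Theory.
Import numFieldNormedType.Exports.

Variables (R : realType) (p : nat) (p_pr : prime p).
Local Notation Zp := (padic_int p_pr).

Let pX_R (k : nat) : 0 < (p%:R ^+ k : R).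
Proof. by rewrite exprn_gt0 // ltr0n prime_gt0. Qed.

Lemma closed_rect (a b c d : R) : closed (`[a, b] `*` `[c, d] : set (R * R)).
Proof.
apply: (@closedI _ (fst @^-1` `[a, b]) (snd @^-1` `[c, d])).
  by apply: preimage_closed; [move=> x _; exact: cvg_fst | exact: interval_closed].
by apply: preimage_closed; [move=> x _; exact: cvg_snd | exact: interval_closed].
Qed.

Lemma plot_unit_square (f : Zp -> Zp) :
  plot f `<=` (`[0, 1] `*` `[0, 1] : set (R * R)).
Proof.
move=> _ [k _ [x _ <-]].
have unit (y : Zp) : (residue y k)%:R / p%:R ^+ k \in `[0, 1 : R].
  rewrite in_itv /= divr_ge0 ?(ltW (pX_R k)) //=.
  by rewrite ler_pdivrMr // mul1r -natrX ler_nat; exact/ltnW/residue_lt.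
by split; exact: unit.
Qed.

Lemma window_cell (i k m c : nat) : (i %/ p ^ k = c)%N ->
  c%:R / p%:R ^+ m <= (i%:R / p%:R ^+ (k + m) : R) <= c.+1%:R / p%:R ^+ m.
Proof.
move=> <-; have pk := pX_gt0 p_pr k.
rewrite exprD invfM mulrA !ler_pM2r ?invr_gt0 //.
rewrite ler_pdivlMr // ler_pdivrMr // -natrX -!natrM !ler_nat.
by rewrite leq_divM ltnW // ltn_ceil.
Qed.

Lemma cell_exists (q : R) (m : nat) : q \in `[0, 1] ->
  exists2 c, (c < p ^ m)%N & c%:R / p%:R ^+ m <= q <= c.+1%:R / p%:R ^+ m.
Proof.
rewrite in_itv /= => /andP[q0 q1].
have [->|q_neq1] := eqVneq q 1.
  (* The last cell is closed on the right, so it also serves q = 1. *)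
  exists (p ^ m).-1; first by rewrite prednK ?pX_gt0.
  rewrite prednK ?pX_gt0 // natrX divff ?gt_eqF // lexx andbT.
  by rewrite ler_pdivrMr // mul1r -natrX ler_nat leq_pred.
have x0 : 0 <= q * p%:R ^+ m by rewrite mulr_ge0 // ltW.
exists (Num.trunc (q * p%:R ^+ m)).
  by rewrite truncn_lt_nat // natrX gtr_pMl // lt_neqAle q_neq1.
have /andP[lo hi] := truncn_itv x0.
by rewrite ler_pdivrMr // lo ler_pdivlMr // ltW.
Qed.

(** All points of a cell of the p^-m grid are within p^-m of each other, so the
    plot is dense in the unit square when it meets every cell. *)
Lemma plot_measure_eq1 (f : Zp -> Zp) :
  (forall m i j, (i < p ^ m)%N -> (j < p ^ m)%N ->
    exists k x, (residue x (k + m) %/ p ^ k = i)%N /\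
                (residue (f x) (k + m) %/ p ^ k = j)%N) ->
  plot_measure R f = 1%E.
Proof.
move=> win; rewrite /plot_measure.
have -> : closure (plot f) = `[0, 1] `*` `[0, 1] :> set (R * R).
  apply/seteqP; split.
    rewrite (closure_id (_ `*` _)).1; last exact: closed_rect.
    exact/closureS/plot_unit_square.
  move=> [u w] [/= u01 w01] V /nbhs_ballP[e /= e0 eV].
  have [m me] : exists m, p%:R ^- m.+1 < e.
    exists (Num.bound e^-1).
    rewrite invf_plt ?posrE //.
    have := archi_boundP (ltW (_ : 0 < e^-1)); rewrite invr_gt0 => /(_ e0) eb.
    apply: lt_le_trans eb _; rewrite -natrX ler_nat.
    by rewrite ltnW // ltnW // ltn_expl // prime_gt1.
  have [i im iu] := cell_exists m.+1 u01; have [j jm jw] := cell_exists m.+1 w01.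
  have [k [x [xi fxj]]] := win _ _ _ im jm.
  have near_cell (c : nat) (s t : R) : c%:R / p%:R ^+ m.+1 <= s <= c.+1%:R / p%:R ^+ m.+1 ->
      c%:R / p%:R ^+ m.+1 <= t <= c.+1%:R / p%:R ^+ m.+1 -> `|s - t| < e.
    rewrite -natr1 mulrDl mul1r => s_c t_c; apply: le_lt_trans me.
    by rewrite ler_norml; lra.
  have xu := window_cell m.+1 xi; have fxw := window_cell m.+1 fxj.
  exists ((residue x (k + m.+1))%:R / p%:R ^+ (k + m.+1),
          (residue (f x) (k + m.+1))%:R / p%:R ^+ (k + m.+1)); split.
    by exists (k + m.+1)%N; [rewrite /= addnS | exists x].
  by apply: eV; split; [exact: near_cell iu xu | exact: near_cell jw fxw].
rewrite product_measure1E; [|exact: measurable_itv..].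
have unit_length : lebesgue_measure (`[0, 1] : set R) = 1%E.
  by rewrite lebesgue_measure_itv /= lte_fin ltr01 oppr0 adde0.
by rewrite -[RHS]mule1; congr (_ * _)%E; exact: unit_length.
Qed.

End PlotMeasure.

Theorem theorem4p4 (R : realType) (p : nat) (p_pr : prime p)
    (A : automaton p) (a : padic_int p_pr) (r : nat) :
  let f : padic_int p_pr -> padic_int p_pr := automaton_fun A in
  let fQ : padic_int p_pr -> padic p_pr := fun x => (f x)%:F in
  let B := padic_ball a r in
  (forall x, B x -> padic_derivable fQ x) ->
  f @` (B `&` naturals) `<=` naturals ->
  (exists v, [/\ (B `&` naturals) v, padic_derivable2 fQ v &
                 padic_derive (padic_derive fQ) v != 0]) ->
  plot_measure R f = 1%E.
Proof.
move=> f fQ B derf natf fv; apply: plot_measure_eq1.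
exact: digit_windows_realized derf natf fv.
Qed.
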